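(* Let $\gamma$ be an odd positive integer and $n$ a positive integer. Suppose that there is a positive integer $N'$ with $C_\gamma^{N'+1}(n)=n$, and let $N$ be the smallest positive integer such that $C_\gamma^{N+1}(n)=n$. Let $\rho$ and $\nu$ be the number of zeros and ones, respectively, among the terms $\chi_\gamma^i(n)$ with $0\le i\le N$. Enumerate the ones among these terms, in order of increasing $i$, as the zeroth, first, $\ldots$, $(\nu-1)$th one. (1) If $n$ is odd, let $m_0=0$, for $1\le j\le \nu-1$ let $m_j$ be the number of zeros between the $(j-1)$th and the $j$th one, and let $m_\nu$ be the number of remaining zeros after the last one. (2) If $n$ is even, let $m_0$ be the number of leading zeros (zeros before the zeroth one), so that $n=2^{m_0}\tilde n$ with $\tilde n$ odd, and for $1\le j\le\nu-1$ let $m_j$ be the number of zeros between the $(j-1)$th and the $j$th one (that is, obtained from $\tilde n$ as in (1)). Then $$n=\frac{\gamma\,2^{m_0}\left(3^{\nu-1}+\sum_{r=1}^{\nu-1}3^{\nu-1-r}\,2^{\sum_{j=1}^{r}m_j}\right)}{2^\rho-3^\nu}.$$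
   Context: For an odd positive integer $\gamma$, the map $C_\gamma:\mathbb{Z}_{>0}\to\mathbb{Z}_{>0}$ is $C_\gamma(x)=3x+\gamma$ if $x$ is odd and $C_\gamma(x)=x/2$ if $x$ is even; $C_\gamma^0(x)=x$ and $C_\gamma^k$ is the $k$-fold iterate. $\chi_\gamma^i(n)\in\{0,1\}$ denotes the parity of $C_\gamma^i(n)$: it is $1$ if $C_\gamma^i(n)$ is odd and $0$ if it is even. *)

(* Defs.v *)
From mathcomp Require Import all_boot.

Set Implicit Arguments.
Unset Strict Implicit.
Unset Printing Implicit Defensive.

(* The domain is the set of positive integers, which [C g] preserves when
   [g] is odd; the value [C g 0 = 0] is never used. *)
Definition C (g x : nat) : nat := if odd x then 3 * x + g else x./2.

Definition chi (g i n : nat) : nat := odd (iter i (C g) n).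

Definition rho (g n N : nat) : nat :=
  count (fun i => chi g i n == 0) (iota 0 N.+1).

Definition nu (g n N : nat) : nat :=
  count (fun i => chi g i n == 1) (iota 0 N.+1).

(* The index i of the k-th one among the terms chi g i n, 0 <= i <= N,
   with ones counted from zero (meaningful for k < nu g n N). *)
Definition one_pos (g n N k : nat) : nat :=
  nth 0 [seq i <- iota 0 N.+1 | chi g i n == 1] k.

(* Half-open range: a <= i < b. *)
Definition zeros_in (g n a b : nat) : nat :=
  count (fun i => chi g i n == 0) (index_iota a b).

(* The numbers m_j. For even n the value at j = nu is not prescribed by the
   convention; it is set to the number of trailing zeros, as for odd n. *)
Definition m (g n N j : nat) : nat :=
  if j == 0 then
    if odd n then 0 else zeros_in g n 0 (one_pos g n N 0)
  else if j < nu g n N then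
    zeros_in g n (one_pos g n N j.-1).+1 (one_pos g n N j)
  else if j == nu g n N then
    zeros_in g n (one_pos g n N j.-1).+1 N.+1
  else 0.

(* Main.v *)
Require Import Defs.
From mathcomp Require Import all_boot all_order all_algebra.

Set Implicit Arguments.
Unset Strict Implicit.
Unset Printing Implicit Defensive.

Import Order.TTheory GRing.Theory Num.Theory.
Local Open Scope ring_scope.

(** Each step of the trajectory is an affine identity: a step from an even
    value [x] reads [2 * C g x = x], a step from an odd one [C g x = 3 * x + g].
    Composing [K] steps and clearing the powers of two expresses [C g ^ K n]
    through [n]: the coefficient of [n] is [3] to the number of odd values, and
    the constant [g] added at the [r]-th odd value is tripled by each later odd
    value and acquires the factor [2] for each halving before it
    ([two_exp_iter_C]). When the trajectory closes up, after [N.+1] steps, this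
    becomes a linear equation for [n] with leading coefficient
    [2 ^ rho - 3 ^ nu].

    It then remains to recognise the number of halvings before the [r]-th odd
    value as [m_0 + ... + m_r] ([zeros_before_one]), and to divide. The
    constant term is positive, and this gives at once that the denominator does
    not vanish. That there is at least one odd value holds because a cycle
    cannot consist of halvings alone ([nu_gt0]). *)

Definition ones_before (g n K : nat) : seq nat :=
  [seq i <- iota 0 K | chi g i n == 1%N].

Lemma chi_eq0 (g i n : nat) : (chi g i n == 0%N) = ~~ (chi g i n == 1%N).
Proof. by rewrite /chi eqb0 eqb1. Qed.

Lemma nuE (g n N : nat) : nu g n N = size (ones_before g n N.+1).
Proof. by rewrite /nu /ones_before size_filter. Qed.

Lemma rhoE (g n N : nat) : rho g n N = zeros_in g n 0 N.+1.
Proof. by rewrite /rho /zeros_in /index_iota subn0. Qed.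

Lemma zeros_in_cat (g n a b c : nat) : (a <= b)%N -> (b <= c)%N ->
  zeros_in g n a c = (zeros_in g n a b + zeros_in g n b c)%N.
Proof.
move=> le_ab le_bc; rewrite /zeros_in -count_cat /index_iota.
have -> : iota b (c - b) = iota (a + (b - a)) (c - b) by rewrite subnKC.
by rewrite -iotaD addnC addnBA // subnK.
Qed.

Lemma zeros_in1 (g n a : nat) : zeros_in g n a a.+1 = (chi g a n == 0%N).
Proof. by rewrite /zeros_in /index_iota subSnn /= addn0. Qed.

Lemma zeros_inS (g n K : nat) :
  zeros_in g n 0 K.+1 = (zeros_in g n 0 K + (chi g K n == 0%N))%N.
Proof. by rewrite (@zeros_in_cat g n 0 K) // zeros_in1. Qed.

Lemma ones_beforeS (g n K : nat) :
  ones_before g n K.+1 =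
    if chi g K n == 1%N then rcons (ones_before g n K) K
    else ones_before g n K.
Proof.
rewrite /ones_before -[K.+1]addn1 iotaD filter_cat /= add0n -cats1.
by case: ifP; rewrite ?cats0.
Qed.

(** The composition of [K] affine steps, by induction on [K]: an odd
    last step triples every term of the sum and appends a new one, while an
    even last step is absorbed by the new factor [2] on the left. *)
Lemma two_exp_iter_C (g n K : nat) :
  (2 ^ zeros_in g n 0 K * iter K (C g) n =
   3 ^ size (ones_before g n K) * n +
   g * \sum_(r < size (ones_before g n K))
         3 ^ (size (ones_before g n K) - 1 - r) *
         2 ^ zeros_in g n 0 (nth 0 (ones_before g n K) r))%N.
Proof.
elim: K => [|K IH]; first by rewrite /= big_ord0 muln0 addn0.
rewrite zeros_inS chi_eq0 ones_beforeS iterS {1}/C.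
have -> : (chi g K n == 1%N) = odd (iter K (C g) n) by rewrite /chi eqb1.
case: ifP => /= parity_x; last first.
  rewrite addn1 expnSr -mulnA -IH; congr (_ * _)%N.
  by rewrite mul2n even_halfK // parity_x.
rewrite addn0 size_rcons big_ord_recr /= nth_rcons ltnn eqxx.
rewrite subn1 /= subnn mul1n mulnDr mulnCA IH.
under [in RHS]eq_bigr => r _.
  (* One more odd value follows, so each exponent of 3 exceeds that in [IH] by one. *)
  rewrite nth_rcons ltn_ord -(subnSK (ltn_ord r)) expnS -mulnA.
  rewrite -[r.+1]add1n subnDA.
over.
rewrite -big_distrr /= mulnDr mulnA -expnS mulnDr addnA.
by rewrite (mulnC (2 ^ _)%N) (mulnCA 3 g).
Qed.

Lemma one_posE (g n N k : nat) :
  one_pos g n N k = nth 0%N (ones_before g n N.+1) k.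
Proof. by []. Qed.

Lemma chi_one_pos (g n N k : nat) : (k < nu g n N)%N ->
  chi g (one_pos g n N k) n = 1%N.
Proof.
rewrite nuE one_posE => lt_k; move: (mem_nth 0%N lt_k).
by rewrite mem_filter => /andP[/eqP].
Qed.

Lemma ltn_one_posS (g n N k : nat) : (k.+1 < nu g n N)%N ->
  (one_pos g n N k < one_pos g n N k.+1)%N.
Proof.
rewrite nuE !one_posE => lt_k.
have ones_sorted : sorted ltn (ones_before g n N.+1).
  exact: sorted_filter ltn_trans _ _ (iota_ltn_sorted _ _).
by apply: (sorted_ltn_nth ltn_trans) => //; rewrite inE // ltnW.
Qed.

(** The special value [m_0 = 0] for odd [n] agrees with the count of leading
    zeros, as the zeroth one is then at position [0]. *)
Lemma m0E (g n N : nat) : m g n N 0 = zeros_in g n 0 (one_pos g n N 0).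
Proof.
rewrite /m /=; case: ifP => // n_odd.
by rewrite /one_pos /= /chi /= n_odd.
Qed.

(** The zeros before a one lie in the gaps between the earlier ones, whose
    lengths are the [m_j]. *)
Lemma zeros_before_one (g n N r : nat) : (r < nu g n N)%N ->
  zeros_in g n 0 (one_pos g n N r) = (\sum_(0 <= j < r.+1) m g n N j)%N.
Proof.
elim: r => [|r IH] lt_r; first by rewrite big_nat1 m0E.
have lt_pos := ltn_one_posS lt_r.
rewrite big_nat_recr //= -IH 1?ltnW // /m /= lt_r.
rewrite (@zeros_in_cat g n 0 (one_pos g n N r).+1) //.
by rewrite zeros_inS chi_one_pos 1?ltnW // addn0.
Qed.

(** Without odd values the trajectory would satisfy [2 ^ N.+1 * n = n]. *)
Lemma nu_gt0 (g n N : nat) : (0 < n)%N -> iter N.+1 (C g) n = n ->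
  (0 < nu g n N)%N.
Proof.
move=> n_gt0 N_period; rewrite lt0n; apply/eqP => nu0.
have := two_exp_iter_C g n N.+1.
rewrite N_period -nuE nu0 big_ord0 muln0 addn0 -rhoE.
move/eqP; rewrite eqn_pmul2r // => /eqP.
have -> : rho g n N = N.+1.
  rewrite -[RHS](size_iota 0) -(count_predC (fun i => chi g i n == 1%N)).
  rewrite -/(nu g n N) nu0 add0n /rho; apply: eq_count => i /=.
  exact: chi_eq0.
by move/eqP; rewrite (eqn_exp2l N.+1 0).
Qed.

(** The formula before division, as an identity between natural numbers. *)
Lemma cycle_equation (g n N : nat) : (0 < n)%N -> iter N.+1 (C g) n = n ->
  (2 ^ rho g n N * n =
   3 ^ nu g n N * n +
   g * 2 ^ m g n N 0 *
     (3 ^ (nu g n N - 1) +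
      \sum_(1 <= r < nu g n N)
        3 ^ (nu g n N - 1 - r) * 2 ^ (\sum_(1 <= j < r.+1) m g n N j)))%N.
Proof.
move=> n_gt0 N_period; have nu_pos := nu_gt0 n_gt0 N_period.
rewrite rhoE -[X in (_ * X)%N]N_period two_exp_iter_C -nuE -mulnA.
congr (_ + g * _)%N.
rewrite -(big_mkord xpredT (fun r => 3 ^ (nu g n N - 1 - r) *
  2 ^ zeros_in g n 0 (one_pos g n N r))%N).
rewrite big_ltn // subn0 -m0E mulnDr mulnC; congr (_ + _)%N.
rewrite big_distrr /=; apply: eq_big_nat => r /andP[_ lt_r].
by rewrite zeros_before_one // big_ltn // expnD mulnCA.
Qed.

Theorem proposition1p5p1 (g n N : nat)
  (g_odd : odd g) (n_gt0 : (0 < n)%N)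
  (N_gt0 : (0 < N)%N)
  (N_period : iter N.+1 (C g) n = n)
  (N_min : forall N' : nat,
     (0 < N')%N -> iter N'.+1 (C g) n = n -> (N <= N')%N) :
  (n%:R : rat) =
    g%:R * 2%:R ^+ m g n N 0 *
      (3%:R ^+ (nu g n N - 1) +
       \sum_(1 <= r < nu g n N)
         3%:R ^+ (nu g n N - 1 - r) *
         2%:R ^+ (\sum_(1 <= j < r.+1) m g n N j)%N)
    / (2%:R ^+ rho g n N - 3%:R ^+ nu g n N).
Proof.
have := cycle_equation n_gt0 N_period.
set T := (_ + \sum_(1 <= r < _) _)%N => eq_n.
have -> : 3%:R ^+ (nu g n N - 1) +
       \sum_(1 <= r < nu g n N)
         3%:R ^+ (nu g n N - 1 - r) *
         2%:R ^+ (\sum_(1 <= j < r.+1) m g n N j)%N = T%:R :> rat.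
  rewrite natrD natrX natr_sum; congr (_ + _).
  by apply: eq_bigr => r _; rewrite natrM !natrX.
have const_gt0 : (0 < g * 2 ^ m g n N 0 * T)%N.
  by rewrite !muln_gt0 odd_gt0 // expn_gt0 addn_gt0 expn_gt0.
have denom_neq0 : 2%:R ^+ rho g n N - 3%:R ^+ nu g n N != 0 :> rat.
  rewrite subr_eq0 -!natrX eqr_nat; apply: contraTneq const_gt0 => eq_pow.
  by move/eqP: eq_n; rewrite eq_pow -[X in X == _]addn0 eqn_add2l => /eqP <-.
apply: canRL (mulfK denom_neq0) _.
rewrite -!natrX -!natrM mulrBr -!natrM !(mulnC n) eq_n natrD.
by rewrite addrC addKr.
Qed.
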